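(* For a matroid $M$, the following statements are equivalent: (1) there are proper flats $F_1$, $F_2$, $F_3$ of $M$ with $|E(M)-(F_1\cup F_2\cup F_3)|\leq 2$; (2) $bw(M^t)\leq r(M^t)$ for all integers $t\geq 3$; (3) $bw(M^t)\leq r(M^t)$ for some integer $t\geq 3$. Consequently, if $E(M)$ is not the union of three proper flats of $M$ and a $2$-element subset of $E(M)$, then $bw(M^t)=r(M^t)+1$ for all $t\in\mathbb{N}$.
   Context: A cyclic flat of a matroid $M$ is a flat $F$ such that $M|F$ has no coloops; $\mathcal{Z}(M)$ denotes the set of cyclic flats, and a matroid is determined by its cyclic flats and their ranks. The $t$-expansion: fix $t\in\mathbb{N}$; for each $e\in E(M)$ let $S_e$ be a $t$-element set with $e\in S_e$, the sets $S_e$ pairwise disjoint; for $X\subseteq E(M)$ let $S_X=\bigcup_{e\in X}S_e$. The $t$-expansion $M^t$ is the matroid on $S_{E(M)}$ whose cyclic flats are exactly the sets $S_A$ with $A\in\mathcal{Z}(M)$, with $r_{M^t}(S_A)=t\cdot r_M(A)$. For $X\subseteq E(M)$ let $\overline{X}=E(M)-X$ and $\lambda_M(X)=r(X)+r(\overline{X})-r(M)$. A branch-decomposition of $M$ is a tree $T$ whose non-leaf vertices all have degree $3$, with an injection from $E(M)$ into the leaves of $T$; each edge $e$ displays the partition $(X,\overline{X})$ given by the labels on leaves of the two components of $T-e$, and has width $\lambda_M(X)+1$. The width of a branch-decomposition is its maximum edge width, and $bw(M)$ is the minimum width over all branch-decompositions of $M$.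
   Formalization: In the last sentence ''a 2-element subset'' is taken as ''a subset with at most 2 elements'' (the failure of (1)); with exactly 2 elements the claim is false for M = U_{1,1}, where bw(M^t) = 1 but r(M^t)+1 = t+1. *)

(* Defs.v *)
From mathcomp Require Import all_boot.
From mathcomp Require Import boolp.

Set Implicit Arguments.
Unset Strict Implicit.
Unset Printing Implicit Defensive.

(* A matroid whose ground set is the finite type [E], given by its rank
   function.  (Ground sets of several matroids are different finite types.) *)
Record matroid (E : finType) := Matroid {
  rk : {set E} -> nat;
  rk_card : forall X : {set E}, rk X <= #|X|;
  rk_mono : forall X Y : {set E}, X \subset Y -> rk X <= rk Y;
  rk_submod : forall X Y : {set E},
    rk (X :|: Y) + rk (X :&: Y) <= rk X + rk Y }.

Definition rank (E : finType) (M : matroid E) : nat := rk M [set: E].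

Definition flat (E : finType) (M : matroid E) (F : {set E}) : bool :=
  [forall x, (x \notin F) ==> (rk M F < rk M (x |: F))].

Definition proper_flat (E : finType) (M : matroid E) (F : {set E}) : bool :=
  flat M F && (F != [set: E]).

(* The restriction M|F has the rank function of [M], on the subsets of [F]. *)
Definition restriction_coloop (E : finType) (M : matroid E) (F : {set E})
    (x : E) : bool :=
  (x \in F) && (rk M (F :\ x) < rk M F).

Definition cyclic_flats (E : finType) (M : matroid E) : {set {set E}} :=
  [set F | flat M F & [forall x, ~~ restriction_coloop M F x]].

(* The subtraction does not truncate, by submodularity. *)
Definition connectivity (E : finType) (M : matroid E) (X : {set E}) : nat :=
  rk M X + rk M (~: X) - rank M.

Lemma rk_le_addD (E : finType) (M : matroid E) (A B : {set E}) :
  rk M A <= rk M B + #|A :\: B|.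
Proof.
apply: leq_trans (rk_mono M _) _; first exact: (subsetUr B A).
have -> : B :|: A = B :|: (A :\: B).
  by apply/setP => x; rewrite !inE; case: (x \in B).
apply: leq_trans (leq_addr (rk M (B :&: (A :\: B))) _) _.
by apply: leq_trans (rk_submod M _ _) _; rewrite leq_add2l rk_card.
Qed.

Lemma cyclic_flats_rank (E : finType) (M : matroid E) (X : {set E}) :
  exists2 A, A \in cyclic_flats M & rk M X = rk M A + #|X :\: A|.
Proof.
pose P B := rk M B + #|X :\: B| == rk M X.
pose pot (B : {set E}) := rk M B * #|E|.+1 + #|~: B|.
have PX : P X by rewrite /P setDv cards0 addn0.
have PE B : rk M B + #|X :\: B| <= rk M X -> P B.
  by move=> le; rewrite /P eqn_leq le rk_le_addD.
case: (arg_minnP pot PX) => A PA minA; exists A; last by rewrite (eqP PA).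
rewrite inE; apply/andP; split; apply/forallP => x.
  apply/implyP => xA; rewrite ltnNge; apply/negP => le.
  have lt : #|~: (x |: A)| < #|~: A|.
    apply: proper_card; rewrite properE setCS subsetUr /= setCS.
    by apply/negP => /subsetP/(_ x); rewrite !inE eqxx (negPf xA) => /(_ isT).
  have PxA : P (x |: A).
    apply: PE; rewrite -(eqP PA) leq_add //.
    by apply/subset_leq_card/setDS/subsetUr.
  have := minA _ PxA; rewrite leqNgt => /negP; apply; rewrite /pot.
  by apply: (leq_trans (n := rk M (x |: A) * #|E|.+1 + #|~: A|));
    rewrite ?ltn_add2l // leq_add2r leq_mul2r le orbT.
apply/negP => /andP[xA lt].
have PxA : P (A :\ x).
  apply: PE; rewrite -(eqP PA).
  apply: (leq_trans (n := rk M (A :\ x) + #|X :\: A|.+1)); last first.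
    by rewrite addnS -addSn leq_add2r.
  rewrite leq_add2l -add1n -(cards1 x).
  apply: leq_trans (subset_leq_card _) (leq_card_setU _ _).
  by apply/subsetP => y; rewrite !inE; case: eqVneq.
have := minA _ PxA; rewrite leqNgt => /negP; apply; rewrite /pot.
apply: (leq_trans (n := (rk M (A :\ x)).+1 * #|E|.+1)); last first.
  by rewrite (leq_trans _ (leq_addr _ _)) // leq_mul2r lt orbT.
by rewrite mulSn addnC ltn_add2r ltnS max_card.
Qed.

(* [E * 'I_t] is the ground set of the t-expansion: the t-element set S_e is
   [[set (e, i) | i : 'I_t]], and [blowup t A] is S_A, the union of the S_e
   for e in [A]. *)
Definition blowup (E : finType) (t : nat) (A : {set E}) : {set E * 'I_t} :=
  [set p | p.1 \in A].

Definition is_expansion (E : finType) (t : nat) (M : matroid E)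
    (N : matroid (E * 'I_t)%type) : Prop :=
  cyclic_flats N = [set blowup t A | A in cyclic_flats M] /\
  (forall A, A \in cyclic_flats M -> rk N (blowup t A) = t * rk M A).

Lemma is_expansion_uniq (E : finType) (t : nat) (M : matroid E)
    (N N' : matroid (E * 'I_t)%type) :
  is_expansion M N -> is_expansion M N' -> rk N =1 rk N'.
Proof.
suff le P Q X : is_expansion (t := t) M P -> is_expansion M Q ->
    rk P X <= rk Q X.
  by move=> hN hN' X; apply/eqP; rewrite eqn_leq !le.
move=> [_ rP] [zQ rQ]; have [C zC ->] := cyclic_flats_rank Q X.
move: zC; rewrite zQ => /imsetP[A zA ->]; rewrite rQ // -rP //; exact: rk_le_addD.
Qed.

(* Witness of existence: the rank function min_A (t * r(A) + |X - S_A|). *)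
Definition expansion_val (E : finType) (t : nat) (M : matroid E)
    (X : {set E * 'I_t}) (A : {set E}) : nat :=
  t * rk M A + #|X :\: blowup t A|.

Definition expansion_rk (E : finType) (t : nat) (M : matroid E)
    (X : {set E * 'I_t}) : nat :=
  expansion_val M X [arg min_(A < set0) expansion_val M X A].

Lemma expansion_rkP (E : finType) (t : nat) (M : matroid E)
    (X : {set E * 'I_t}) :
  (exists A, expansion_rk M X = expansion_val M X A) /\
  (forall A, expansion_rk M X <= expansion_val M X A).
Proof.
by rewrite /expansion_rk; case: arg_minnP => // A _ minA; split=> [|B];
  [exists A | apply: minA].
Qed.

Lemma expansion_rk_card (E : finType) (t : nat) (M : matroid E)
    (X : {set E * 'I_t}) : expansion_rk M X <= #|X|.
Proof.
apply: leq_trans ((expansion_rkP M X).2 set0) _.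
have := rk_card M set0; rewrite /expansion_val cards0 leqn0 => /eqP ->.
by rewrite muln0 subset_leq_card // subsetDl.
Qed.

Lemma expansion_rk_mono (E : finType) (t : nat) (M : matroid E)
    (X Y : {set E * 'I_t}) :
  X \subset Y -> expansion_rk M X <= expansion_rk M Y.
Proof.
move=> sXY; have [A ->] := (expansion_rkP M Y).1.
apply: leq_trans ((expansion_rkP M X).2 A) _.
by rewrite leq_add2l subset_leq_card // setSD.
Qed.

Lemma expansion_rk_submod (E : finType) (t : nat) (M : matroid E)
    (X Y : {set E * 'I_t}) :
  expansion_rk M (X :|: Y) + expansion_rk M (X :&: Y) <=
  expansion_rk M X + expansion_rk M Y.
Proof.
have [A ->] := (expansion_rkP M X).1; have [B ->] := (expansion_rkP M Y).1.
apply: leq_trans (leq_add ((expansion_rkP M _).2 (A :|: B))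
                          ((expansion_rkP M _).2 (A :&: B))) _.
rewrite /expansion_val addnACA [leqRHS]addnACA -!mulnDr leq_add //.
  by rewrite leq_mul2l rk_submod orbT.
rewrite -cardsUI -[leqRHS]cardsUI leq_add // subset_leq_card //;
  apply/subsetP => p; rewrite !inE;
  by case: (p \in X); case: (p \in Y); case: (p.1 \in A); case: (p.1 \in B).
Qed.

Definition expansion_matroid (E : finType) (t : nat) (M : matroid E) :=
  Matroid (@expansion_rk_card E t M) (@expansion_rk_mono E t M)
          (@expansion_rk_submod E t M).

Lemma card_blowup (E : finType) (t : nat) (A : {set E}) :
  #|blowup t A| = t * #|A|.
Proof.
have -> : blowup t A = setX A [set: 'I_t].
  by apply/setP => p; rewrite !inE andbT.
by rewrite cardsX cardsT card_ord mulnC.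
Qed.

Lemma blowupD (E : finType) (t : nat) (A B : {set E}) :
  blowup t A :\: blowup t B = blowup t (A :\: B).
Proof. by apply/setP => p; rewrite !inE. Qed.

Lemma expansion_rk_blowup (E : finType) (t : nat) (M : matroid E)
    (A : {set E}) : expansion_rk M (blowup t A) = t * rk M A.
Proof.
apply/eqP; rewrite eqn_leq; apply/andP; split.
  apply: leq_trans ((expansion_rkP M _).2 A) _.
  by rewrite /expansion_val setDv cards0 addn0.
have [B ->] := (expansion_rkP M (blowup t A)).1.
by rewrite /expansion_val blowupD card_blowup -mulnDr leq_mul2l rk_le_addD orbT.
Qed.

Lemma is_expansion_exists (E : finType) (t : nat) (M : matroid E) :
  exists N : matroid (E * 'I_t)%type, is_expansion M N.
Proof.
exists (expansion_matroid t M); split; last by move=> A _; exact: expansion_rk_blowup.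
apply/setP => F; apply/idP/imsetP; last first.
  move=> [A]; rewrite !inE => /andP[/forallP flA /forallP cyA] ->.
  apply/andP; split; apply/forallP => -[e i]; rewrite ?inE /=.
    apply/implyP => eA; rewrite expansion_rk_blowup.
    have t0 : 0 < t by apply: leq_ltn_trans (ltn_ord i).
    have [B ->] := (expansion_rkP M ((e, i) |: blowup t A)).1.
    have [eB|eB] := boolP (e \in B).
      have := flA e; rewrite eA /= => lt.
      apply: (leq_trans (n := t * rk M (e |: A))).
        by rewrite (leq_trans _ (_ : t * (rk M A).+1 <= _)) ?leq_mul2l ?lt ?orbT //
          mulnS -add1n leq_add2r.
      apply: (leq_trans (n := t * (rk M B + #|(e |: A) :\: B|))).
        by rewrite leq_mul2l rk_le_addD orbT.
      rewrite mulnDr leq_add2l -card_blowup -blowupD subset_leq_card //.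
      apply/subsetP => p; rewrite !inE => /andP[pB].
      rewrite pB /= => /orP[/eqP pe|->]; last by rewrite orbT.
      by rewrite pe eB in pB.
    apply: (leq_ltn_trans (n := t * (rk M B + #|A :\: B|))).
      by rewrite leq_mul2l rk_le_addD orbT.
    rewrite mulnDr ltn_add2l -card_blowup -blowupD proper_card // properE.
    rewrite setSD ?subsetUr //=; apply/negP => /subsetP/(_ (e, i)).
    by rewrite !inE eqxx /= eB (negPf eA) => /(_ isT).
  apply/negP => /andP[]; rewrite inE /= => eA; apply/negP; rewrite -leqNgt.
  rewrite expansion_rk_blowup.
  have := cyA e; rewrite /restriction_coloop eA /= -leqNgt => le.
  have [B ->] := (expansion_rkP M (blowup t A :\ (e, i))).1.
  have [eB|eB] := boolP (e \in B).
    apply: (leq_trans (n := t * (rk M B + #|A :\: B|))).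
      by rewrite leq_mul2l rk_le_addD orbT.
    rewrite mulnDr leq_add2l -card_blowup -blowupD subset_leq_card //.
    apply/subsetP => p; rewrite !inE => /andP[pB ->]; rewrite pB !andbT /=.
    by apply: contraNneq pB => ->.
  apply: (leq_trans (n := t * rk M (A :\ e))); first by rewrite leq_mul2l le orbT.
  apply: (leq_trans (n := t * (rk M B + #|(A :\ e) :\: B|))).
    by rewrite leq_mul2l rk_le_addD orbT.
  rewrite mulnDr leq_add2l -card_blowup -blowupD subset_leq_card //.
  apply/subsetP => p; rewrite !inE => /and3P[-> pe ->]; rewrite andbT /=.
  by apply: contraNneq pe => ->.
have [t0|t0] := posnP t.
  move=> _; have [A zA _] := cyclic_flats_rank M set0; exists A => //.
  by apply/setP => -[e i]; have := ltn_ord i; rewrite {2}t0.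
rewrite !inE => /andP[/forallP flF /forallP cyF].
have [B rB] := (expansion_rkP M F).1.
have sFB : F \subset blowup t B.
  apply/subsetP => p pF; apply: contraT => pB.
  have := cyF p; rewrite /restriction_coloop pF /= -leqNgt rB => le.
  have := leq_trans le ((expansion_rkP M _).2 B).
  rewrite leq_add2l leqNgt => /negP[]; apply: proper_card; rewrite properE.
  rewrite setSD ?subsetDl //=; apply/negP => /subsetP/(_ p).
  by rewrite in_setD pB pF => /(_ isT); rewrite !inE eqxx andbF.
have {}rB : expansion_rk M F = t * rk M B.
  rewrite rB /expansion_val; move: sFB; rewrite -setD_eq0 => /eqP ->.
  by rewrite cards0 addn0.
have flF' C : F \subset blowup t C -> rk M C <= rk M B -> blowup t C \subset F.
  move=> sFC le; apply/subsetP => p pC; apply: contraT => pF.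
  have := flF p; rewrite pF /= rB ltnNge => /negP[].
  apply: leq_trans (_ : expansion_rk M (blowup t C) <= _).
    by apply: expansion_rk_mono; rewrite subUset sub1set pC sFC.
  by rewrite expansion_rk_blowup leq_mul2l le orbT.
have eF : F = blowup t B by apply/eqP; rewrite eqEsubset sFB flF'.
exists B => //; rewrite inE; apply/andP; split; apply/forallP => e.
  apply/implyP => eB; rewrite ltnNge; apply/negP => le.
  have /subsetP/(_ (e, Ordinal t0)) : blowup t (e |: B) \subset F.
    apply: flF' => //; apply: subset_trans sFB _.
    by apply/subsetP => p; rewrite !inE => ->; rewrite orbT.
  by rewrite eF !inE eqxx (negPf eB) => /(_ isT).
apply/negP => /andP[eB lt].
have := cyF (e, Ordinal t0); rewrite /restriction_coloop eF inE /= eB /=.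
rewrite expansion_rk_blowup; case/negP.
apply: leq_ltn_trans ((expansion_rkP M _).2 (B :\ e)) _.
apply: (leq_trans (n := t * (rk M (B :\ e)).+1)); last first.
  by rewrite leq_mul2l lt orbT.
rewrite /expansion_val mulnSr ltn_add2l.
apply: (leq_trans (n := (#|blowup t [set e] :\ (e, Ordinal t0)|).+1)).
  rewrite ltnS subset_leq_card //; apply/subsetP => p; rewrite !inE.
  by case: (p.1 \in B); rewrite ?andbF // andbT negbK andbT andbC.
have := cardsD1 (e, Ordinal t0) (blowup t [set e]).
by rewrite card_blowup cards1 muln1 !inE eqxx add1n => <-.
Qed.

Definition expansion (E : finType) (t : nat) (M : matroid E) :
    matroid (E * 'I_t)%type :=
  sval (cid (is_expansion_exists t M)).

Lemma expansionP (E : finType) (t : nat) (M : matroid E) :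
  is_expansion M (expansion t M).
Proof. exact: svalP (cid (is_expansion_exists t M)). Qed.

(* A finite simple graph is a symmetric irreflexive relation.  A [ucycle] of
   size 2 only runs back and forth along one edge. *)
Definition is_tree (V : finType) (e : rel V) : Prop :=
  [/\ symmetric e, irreflexive e, 0 < #|V|, (forall x y, connect e x y) &
      forall c, ucycle e c -> size c <= 2].

Definition degree (V : finType) (e : rel V) (v : V) : nat := #|[set w | e v w]|.

Definition leaf (V : finType) (e : rel V) (v : V) : bool := degree e v == 1.

(* A branch-decomposition of a matroid on [E]; it depends on the ground set
   only.  Some leaves may carry no label. *)
Record branch_decomposition (E : finType) := BranchDecomposition {
  bd_vertex : finType;
  bd_edge : rel bd_vertex;
  bd_tree : is_tree bd_edge;
  bd_degree3 : forall v, ~~ leaf bd_edge v -> degree bd_edge v = 3;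
  bd_label : E -> bd_vertex;
  bd_label_inj : injective bd_label;
  bd_label_leaf : forall x, leaf bd_edge (bd_label x) }.

Definition delete_edge (V : finType) (e : rel V) (u v : V) : rel V :=
  [rel x y | [&& e x y, (x, y) != (u, v) & (x, y) != (v, u)]].

(* The labels in the component of T - uv that contains u.  The component of v
   gives the complement, which has the same connectivity. *)
Definition displayed (E : finType) (D : branch_decomposition E)
    (u v : bd_vertex D) : {set E} :=
  [set x | connect (delete_edge (@bd_edge E D) u v) u (bd_label D x)].

Definition width (E : finType) (M : matroid E) (D : branch_decomposition E) :
    nat :=
  \max_(p : bd_vertex D * bd_vertex D | bd_edge p.1 p.2)
     (connectivity M (displayed p.1 p.2)).+1.

(* Existence of branch-decompositions: replace a leaf by a vertex of degree 3
   with two new leaves until there are enough leaves. *)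
Definition grow (V : finType) (e : rel V) (l : V) : rel (V + bool) :=
  fun x y => match x, y with
    | inl a, inl b => e a b
    | inl a, inr _ => a == l
    | inr _, inl b => b == l
    | inr _, inr _ => false
    end.

Lemma ucycle_degree (V : finType) (e : rel V) (c : seq V) (x : V) :
  symmetric e -> ucycle e c -> 2 < size c -> x \in c ->
  exists y z, [/\ y != z, e x y & e x z].
Proof.
move=> esym /andP[cyc uniqc] szc xc.
case: (rot_to xc) => i s def_c.
have {cyc} : cycle e (x :: s) by rewrite -def_c rot_cycle.
have {uniqc} : uniq (x :: s) by rewrite -def_c rot_uniq.
have {szc} : 2 < size (x :: s) by rewrite -def_c size_rot.
case: s {def_c} => [|y s] //; case/lastP: s => [|s z] //= _.
rewrite mem_rcons inE rcons_path last_rcons => /and3P[_ + _].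
rewrite negb_or => /andP[yz _] /and3P[exy _ ezx].
by exists y, z; rewrite yz exy esym ezx.
Qed.

Lemma grow_tree (V : finType) (e : rel V) (l : V) :
  is_tree e -> is_tree (grow e l).
Proof.
case=> esym eirr V0 conn acyc.
have gsym : symmetric (grow e l) by case=> [a|a] [b|b] //=.
have csym := sym_connect_sym gsym.
have cl a : connect (grow e l) (inl a) (inl l).
  have /connectP[p pp ->] := conn a l.
  elim: p a pp => [|b p IH] a /=; first by rewrite connect0.
  case/andP=> ab /IH; apply: connect_trans; exact: connect1.
have cL x : connect (grow e l) x (inl l).
  by case: x => [a|b]; [exact: cl | apply: connect1; rewrite /= eqxx].
split=> //; first by case.
- by rewrite card_sum addn_gt0 V0.
- by move=> x y; apply: connect_trans (cL x) _; rewrite csym.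
move=> c uc; rewrite leqNgt; apply/negP => szc.
have cV x : x \in c -> exists a, x = inl a.
  case: x => [a|b] xc; first by exists a.
  have [[y|y] [[z|z] [yz]]] //= := ucycle_degree gsym uc szc xc.
  by move=> /eqP yl /eqP zl; rewrite yl zl eqxx in yz.
have [c' def_c] : exists c' : seq V, c = map inl c'.
  elim: c cV {uc szc} => [|x c IH] cV; first by exists [::].
  have [a ->] := cV x (mem_head _ _).
  have [|c' ->] := IH; last by exists (a :: c').
  by move=> y yc; apply: cV; rewrite inE yc orbT.
have : ucycle e c'.
  move: uc; rewrite def_c /ucycle => /andP[cyc uniqc].
  rewrite (map_uniq uniqc) andbT.
  case: c' cyc {def_c uniqc} => //= a s; rewrite -map_rcons.
  move: (rcons s a) => q; by elim: q a {s} => //= b q IH a /andP[-> /IH].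
by move/acyc; rewrite leqNgt; move: szc; rewrite def_c size_map => ->.
Qed.

Lemma grow_degree_inl (V : finType) (e : rel V) (l v : V) :
  degree (grow e l) (inl v) = degree e v + (v == l).*2.
Proof.
rewrite /degree !cardsE -!sum1_card big_sumType /=; congr (_ + _).
rewrite sum1_card; case: eqVneq => [->|nvl] /=.
  by rewrite -[RHS]card_bool; apply: eq_card => b; exact: (eqxx l).
by apply: eq_card0 => b; exact: (negPf nvl).
Qed.

Lemma grow_degree_inr (V : finType) (e : rel V) (l : V) (b : bool) :
  degree (grow e l) (inr b) = 1.
Proof.
rewrite /degree -(cards1 (inl l : V + bool)); apply: eq_card => -[a|a];
by rewrite !inE.
Qed.

Lemma cubic_tree_exists (n : nat) :
  exists V : finType, exists e : rel V,
    [/\ is_tree e, forall v, ~~ leaf e v -> degree e v = 3 &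
        n < #|[set v | leaf e v]|].
Proof.
elim: n => [|n [V [e [tree_e deg3 nle]]]].
  exists bool, (fun x y => x != y).
  have deg1 b : degree (fun x y : bool => x != y) b = 1.
    rewrite /degree -(cards1 (~~ b)); apply: eq_card => c; rewrite !inE.
    by case: b; case: c.
  split.
  - split; rewrite ?card_bool //.
    + by move=> x y; rewrite eq_sym.
    + by move=> x; rewrite eqxx.
    + by move=> x y; case: (eqVneq x y) => [->|xy]; [exact: connect0 | exact: connect1].
    + by move=> c /andP[_ /card_uniqP <-]; rewrite -card_bool max_card.
  - by move=> v; rewrite /leaf deg1.
  - by apply/card_gt0P; exists true; rewrite inE /leaf deg1.
have /card_gt0P[l] : 0 < #|[set v | leaf e v]| by apply: leq_trans nle.
rewrite inE => /eqP dl; exists (V + bool)%type, (grow e l); split.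
- exact: grow_tree.
- case=> [v|b]; rewrite /leaf ?grow_degree_inr // grow_degree_inl.
  by case: (eqVneq v l) => [->|_]; rewrite ?dl // double0 addn0; exact: deg3.
have lL : l \in [set v | leaf e v] by rewrite inE /leaf dl.
rewrite -(ltn_add2r 1) addn1 in nle.
apply: (leq_trans (n := #|[set v | leaf e v] :\ l| + 2)).
  by move: nle; rewrite (cardsD1 l) lL add1n addn1 addn2.
rewrite !cardsE -!sum1_card big_sumType /= leq_add //.
  rewrite !sum1_card; apply: subset_leq_card; apply/subsetP => v.
  case/andP; rewrite !inE => vl lv.
  suff : leaf (grow e l) (inl v) by [].
  by rewrite /leaf grow_degree_inl (negPf vl) double0 addn0.
rewrite sum1_card -card_bool; apply: subset_leq_card; apply/subsetP => b _.
suff : leaf (grow e l) (inr b) by [].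
by rewrite /leaf grow_degree_inr.
Qed.

Lemma branch_decomposition_exists (E : finType) (M : matroid E) :
  exists k, `[< exists D : branch_decomposition E, width M D = k >].
Proof.
have [V [e [te d3 nle]]] := cubic_tree_exists #|E|.
pose f (x : E) : V := enum_val (widen_ord (ltnW nle) (enum_rank x)).
have injf : injective f.
  move=> x y /enum_val_inj/(congr1 val)/= /ord_inj; exact: enum_rank_inj.
have leaff x : leaf e (f x).
  by have := enum_valP (widen_ord (ltnW nle) (enum_rank x)); rewrite inE.
exists (width M (BranchDecomposition te d3 injf leaff)).
by apply/asboolP; exists (BranchDecomposition te d3 injf leaff).
Qed.

Definition branch_width (E : finType) (M : matroid E) : nat :=
  ex_minn (branch_decomposition_exists M).

(* Main.v *)
Require Import Defs.
From mathcomp Require Import all_boot.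
From mathcomp Require Import boolp zify.

(** Call a set spanning when its rank is the full rank.  An edge of width at
    most [r] of a branch-decomposition cannot have two spanning sides, so
    following the spanning sides to a smallest one ends at a vertex whose
    branches are all non-spanning; conversely, three non-spanning sets that
    cover the ground set can be hung on the three branches of a cubic tree.
    Hence [bw <= r] amounts to a cover of the ground set by three non-spanning
    sets, up to one element.  In the t-expansion a set [X] has rank
    [t * r(A) + |X - S_A|] for some flat [A]; counting the clones that three
    non-spanning sets contain outside the [S_A] bounds the number of elements of
    [E] outside the three flats by the sum of the coranks minus one, and all
    but two of them can be absorbed by raising the flats to corank one. *)

Set Implicit Arguments.
Unset Strict Implicit.
Unset Printing Implicit Defensive.

(** * Edge cuts in trees *)

Lemma delete_edgeC (V : finType) (e : rel V) (u v : V) :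
  delete_edge e u v =2 delete_edge e v u.
Proof. by move=> x y /=; congr (_ && _); rewrite andbC. Qed.

Lemma delete_edge_sym (V : finType) (e : rel V) (u v : V) :
  symmetric e -> symmetric (delete_edge e u v).
Proof.
move=> sym_e x y; rewrite /delete_edge /= sym_e !xpair_eqE; congr (_ && _).
by rewrite andbC (andbC (y == v)) (andbC (y == u)).
Qed.

Lemma delete_edge_avoiding (V : finType) (e : rel V) (u v x y : V) :
  x != u -> y != u -> delete_edge e u v x y = e x y.
Proof.
move=> /negPf xu /negPf yu; rewrite /delete_edge /= !xpair_eqE xu yu.
by rewrite andbF !andbT.
Qed.

Section Trees.

Variables (V : finType) (e : rel V).
Hypothesis tree_e : is_tree e.

Let esym : symmetric e. Proof. by case: tree_e. Qed.

Definition component (u v : V) : {set V} :=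
  [set x | connect (delete_edge e u v) u x].

Lemma component_refl (u v : V) : u \in component u v.
Proof. by rewrite inE connect0. Qed.

(** A path from [u] to [v] without the edge [uv], made simple, closes up with that edge to a
    [ucycle]. The bound 2 on its size leaves only a loop or the deleted edge itself. *)
Lemma tree_edge_separates (u v : V) : e u v -> v \notin component u v.
Proof.
case: tree_e => _ eirr _ _ acyc euv; apply/negP; rewrite inE.
case/connectP=> p pp; case: (shortenP pp) => q pq uq _ lq.
have : ucycle e (u :: q).
  rewrite /ucycle uq andbT /= rcons_path -lq esym euv andbT.
  by apply: sub_path pq => x y /andP[].
move/acyc; case: q pq uq lq => [|x [|y q]] //=.
  by move=> _ _ vu; rewrite vu eirr in euv.
by rewrite /delete_edge /= andbT => + _ vx; rewrite -vx eqxx /= andbF.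
Qed.

(** The vertex [w] is the first step of a simple path from [u] to [x]; the rest of the path avoids
    [u], hence the edge [uw]. *)
Lemma component_neighbor (u x : V) :
  x != u -> exists2 w, e u w & x \in component w u.
Proof.
case: tree_e => _ _ _ conn _; have /connectP[p pp ->] := conn u x.
case: (shortenP pp) => -[|w q] /=; first by rewrite eqxx.
move=> /andP[euw pq] /andP[]; rewrite inE negb_or => /andP[uw uq] _ _ _.
exists w => //; rewrite inE; apply/connectP; exists q => //.
suff avoid a :
    u != a -> u \notin q -> path e a q -> path (delete_edge e w u) a q.
  exact: avoid.
elim: q a {pq uq} => //= b q IH a ua; rewrite inE negb_or => /andP[ub uq].
case/andP=> eab pq; rewrite delete_edgeC delete_edge_avoiding ?eab 1?eq_sym //.
exact: IH.
Qed.

(** Along a walk in the tree, only a step across [uv] itself can change sides. *)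
Lemma componentC (u v : V) : e u v -> ~: component u v = component v u.
Proof.
move=> euv; case: tree_e => _ _ _ conn _.
have csym := sym_connect_sym (delete_edge_sym u v esym).
have compE x : (x \in component v u) = connect (delete_edge e u v) v x.
  by rewrite inE (eq_connect (delete_edgeC e v u)).
apply/setP => x; rewrite in_setC compE; apply/idP/idP; last first.
  move=> vx; apply: contra (tree_edge_separates euv); rewrite !inE => ux.
  by rewrite (connect_trans ux) // csym.
rewrite inE; have /connectP[p pp ->] := conn u x.
elim/last_ind: p pp => [|p y IH] /=; first by rewrite connect0.
rewrite rcons_path last_rcons => /andP[/IH{}IH]; set z := last u p => ezy nuy.
have [zy|] := boolP (delete_edge e u v z y).
  apply: (connect_trans (IH _) (connect1 zy)).
  by apply: contra nuy => uz; apply: connect_trans uz (connect1 zy).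
rewrite /delete_edge /= ezy /= -negb_or negbK !xpair_eqE.
case/orP=> /andP[_ /eqP yE]; first by rewrite yE connect0.
by rewrite yE connect0 in nuy.
Qed.

(** A walk from [w] without the edge [uw] never meets [u], so it avoids [uv] too; the vertex [u]
    makes the inclusion strict. This drives the descent to a smallest spanning side. *)
Lemma component_proper (u v w : V) :
  e u v -> e u w -> w != v -> component w u \proper component u v.
Proof.
move=> euv euw wv; rewrite properE; apply/andP; split; last first.
  apply/negP => /subsetP/(_ u (component_refl u v)); apply/negP.
  by apply: tree_edge_separates; rewrite esym.
have uw : w != u.
  by case: tree_e => _ eirr _ _ _; apply: contraTneq euw => ->; rewrite eirr.
apply/subsetP => x; rewrite inE => /connectP[p pp ->].
elim/last_ind: p pp => [|p y IH] /=.
  by rewrite inE connect1 // /delete_edge /= euw !xpair_eqE (negPf wv)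
    (negPf uw) !andbF.
rewrite rcons_path last_rcons => /andP[pp]; have {}IH := IH pp.
move: IH; set z := last w p => IH zy.
have nu a : connect (delete_edge e w u) w a -> a != u.
  move=> ca; have ewu : e w u by rewrite esym.
  apply: contraNneq (tree_edge_separates ewu) => au.
  by move: ca; rewrite au inE.
have cz : connect (delete_edge e w u) w z by apply/connectP; exists p.
have zu := nu z cz.
have yu : y != u by apply: nu (connect_trans cz (connect1 zy)).
move: IH; rewrite !inE => IH; apply: connect_trans IH (connect1 _).
by rewrite delete_edge_avoiding //; case/andP: zy.
Qed.

End Trees.

(** * Spanning sets, flats and connectivity *)

Section Matroid.

Variables (E : finType) (M : matroid E).

Lemma rk_le_rank (X : {set E}) : rk M X <= rank M.
Proof. by apply: rk_mono; apply: subsetT. Qed.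

Lemma rk_set0 : rk M set0 = 0.
Proof. by apply/eqP; rewrite -leqn0 -(cards0 E) rk_card. Qed.

Lemma rk_setU_card (A B : {set E}) : rk M (A :|: B) <= rk M A + #|B|.
Proof.
apply: leq_trans (rk_le_addD M _ A) _; rewrite leq_add2l subset_leq_card //.
by apply/subsetP => x; rewrite !inE; case: (x \in A).
Qed.

(** A maximal non-spanning superset is a flat, since any further element makes it spanning. *)
Lemma nonspanning_proper_flat (A : {set E}) :
  rk M A < rank M -> exists2 F, proper_flat M F & A \subset F.
Proof.
move=> ltA; pose nonspanning B := rk M B < rank M.
have [F /maxsetP[ltF maxF] sAF] := @maxset_exists _ nonspanning A ltA.
exists F => //; apply/andP; split; last first.
  by apply: contraTneq ltF => ->; rewrite /nonspanning ltnn.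
apply/forallP => x; apply/implyP => xF; apply: leq_trans ltF _.
rewrite leqNgt; apply/negP => lt; move: xF.
by rewrite -(maxF _ lt (subsetUr _ _)) setU11.
Qed.

Lemma proper_flat_nonspanning (F : {set E}) :
  proper_flat M F -> rk M F < rank M.
Proof.
case/andP=> /forallP flF nT.
have [x xF] : exists x, x \notin F.
  apply/existsP; rewrite -negb_forall; apply: contra nT => /forallP allF.
  by apply/eqP/setP => x; rewrite inE allF.
by have := flF x; rewrite xF => /leq_trans; apply; apply: rk_le_rank.
Qed.

Lemma connectivity_le_rk (X : {set E}) : connectivity M X <= rk M X.
Proof. by rewrite /connectivity leq_subLR addnC leq_add2r rk_le_rank. Qed.

Lemma connectivityC (X : {set E}) : connectivity M (~: X) = connectivity M X.
Proof. by rewrite /connectivity setCK addnC. Qed.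

End Matroid.

Lemma card_split (T : finType) (R : {set T}) (a b : nat) :
  #|R| <= a + b -> exists B : {set T}, #|B| <= a /\ #|R :\: B| <= b.
Proof.
move=> leR; exists [set x in take a (enum R)]; split.
  rewrite cardsE (leq_trans (card_size _)) // size_take.
  by case: ltnP.
apply: (leq_trans (n := #|[set x in drop a (enum R)]|)).
  apply/subset_leq_card/subsetP => x; rewrite !inE => /andP[nx xR].
  have : x \in enum R by rewrite mem_enum.
  by rewrite -{1}(cat_take_drop a (enum R)) mem_cat (negPf nx).
rewrite cardsE (leq_trans (card_size _)) // size_drop -cardE.
by rewrite leq_subLR.
Qed.

(** * From small branch-width to three non-spanning sets *)

Section BranchWidth.

Variables (E : finType) (N : matroid E).

Lemma displayed_component (D : branch_decomposition E) (u v : bd_vertex D) x :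
  (x \in displayed u v) = (bd_label D x \in component (@bd_edge E D) u v).
Proof. by rewrite !inE. Qed.

Lemma displayedC (D : branch_decomposition E) (u v : bd_vertex D) :
  bd_edge u v -> ~: displayed u v = displayed v u.
Proof.
move=> euv; apply/setP => x.
by rewrite in_setC !displayed_component -(componentC (bd_tree D) euv) in_setC.
Qed.

Lemma bd_edge_exists (D : branch_decomposition E) :
  exists u v : bd_vertex D, bd_edge u v.
Proof.
case: (bd_tree D) => _ _ /card_gt0P[u _] _ _.
have : 0 < degree (@bd_edge E D) u.
  have [|/bd_degree3 ->] := boolP (leaf (@bd_edge E D) u) => //.
  by rewrite /leaf => /eqP ->.
by case/card_gt0P=> v; rewrite inE; exists u, v.
Qed.

Lemma width_edge (D : branch_decomposition E) (u v : bd_vertex D) :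
  bd_edge u v -> connectivity N (displayed u v) < width N D.
Proof.
move=> euv; rewrite /width.
exact: (@leq_bigmax_cond _ _ (fun p => (connectivity N (displayed p.1 p.2)).+1)
  (u, v)).
Qed.

Lemma branch_width_attained :
  exists D : branch_decomposition E, width N D = branch_width N.
Proof. by rewrite /branch_width; case: ex_minnP => k /asboolP. Qed.

Lemma branch_width_le (D : branch_decomposition E) :
  branch_width N <= width N D.
Proof.
rewrite /branch_width; case: ex_minnP => k _; apply.
by apply/asboolP; exists D.
Qed.

Lemma branch_width_le_rank1 : branch_width N <= (rank N).+1.
Proof.
have [D <-] := branch_width_attained; apply/bigmax_leqP => p _.
by rewrite ltnS (leq_trans (connectivity_le_rk _ _)) // rk_le_rank.
Qed.

Lemma branch_width_gt0 : 0 < branch_width N.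
Proof.
have [D <-] := branch_width_attained; have [u [v euv]] := bd_edge_exists D.
exact: leq_ltn_trans (width_edge euv).
Qed.

(** With [r] the rank, two spanning sides would give connectivity [r + r - r = r], that is, width
    [r + 1]. *)
Lemma nonspanning_side (D : branch_decomposition E) (u v : bd_vertex D) :
  width N D <= rank N -> bd_edge u v ->
  (rk N (displayed u v) < rank N) || (rk N (displayed v u) < rank N).
Proof.
move=> leD euv; have := leq_trans (width_edge euv) leD.
rewrite /connectivity displayedC // => lt.
have := rk_le_rank N (displayed u v); have := rk_le_rank N (displayed v u).
lia.
Qed.

(** The one exceptional element is the label of a leaf at which the descent may stop. *)
Lemma three_nonspanning_of_branch_width :
  branch_width N <= rank N ->
  exists X1 X2 X3 : {set E},
    [/\ rk N X1 < rank N, rk N X2 < rank N, rk N X3 < rank N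
      & #|~: (X1 :|: X2 :|: X3)| <= 1].
Proof.
(* Widths are positive, so the rank is too; hence [set0] is non-spanning and can pad the triple. *)
move=> lebw; have r0 := leq_trans branch_width_gt0 lebw.
have [D eqD] := branch_width_attained; rewrite -eqD in lebw.
have tD := bd_tree D; set e := @bd_edge E D in tD.
have sym_e : symmetric e by case: tD.
pose P (p : bd_vertex D * bd_vertex D) :=
  e p.1 p.2 && (rank N <= rk N (displayed p.1 p.2)).
(* If no side is spanning, the two sides of any edge give a cover. *)
have [[p0 Pp0]|nP] := pselect (exists p, P p); last first.
  have [u [v euv]] := bd_edge_exists D.
  have ns a b : e a b -> rk N (displayed a b) < rank N.
    by move=> eab; rewrite ltnNge; apply/negP => le; apply: nP;
      exists (a, b); rewrite /P /= eab le.
  exists (displayed u v), (displayed v u), set0; split.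
  - exact: ns.
  - by apply: ns; rewrite sym_e.
  - by rewrite rk_set0.
  by rewrite setU0 -(displayedC euv) setUCr setCT cards0.
case: (arg_minnP (fun p => #|component e p.1 p.2|) Pp0) => -[u v].
move=> /andP[/= euv sp] minuv.
have nsv : rk N (displayed v u) < rank N.
  by have := nonspanning_side lebw euv; rewrite ltnNge sp.
(* The branch at [v] lies opposite a spanning side; any other spanning branch at [u] would
   contradict minimality. *)
have nsw w : e u w -> rk N (displayed w u) < rank N.
  move=> euw; have [->//|wv] := eqVneq w v.
  rewrite ltnNge; apply/negP => le.
  have Pw : P (w, u) by rewrite /P /= sym_e euw le.
  have := minuv _ Pw; rewrite /= leqNgt => /negP; apply.
  exact: proper_card (component_proper tD euv euw wv).
(* At a leaf [u], the side opposite the branch at [v] holds no label except possibly that of [u]. *)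
have [lu|/bd_degree3] := boolP (leaf e u).
  exists (displayed v u), set0, set0; split; rewrite ?rk_set0 //.
  rewrite !setU0 displayedC; last by rewrite -/e sym_e.
  have labu x : x \in displayed u v -> bd_label D x = u.
    rewrite displayed_component => xuv; apply/eqP; apply: contraT.
    move=> /(component_neighbor tD)[w euw].
    have -> : w = v.
      move: lu; rewrite /leaf /degree => /cards1P[a /setP eqa].
      have := eqa w; have := eqa v; rewrite !inE euw euv.
      by move=> /esym/eqP -> /esym/eqP ->.
    by rewrite -(componentC tD euv) in_setC xuv.
  apply/card_le1_eqP => x y xu yu; apply: (@bd_label_inj _ D).
  by rewrite !labu.
(* The three branches at a vertex of degree 3 miss only [u], which carries no label because labels
   sit on leaves. *)
rewrite -/e => d3; have := d3; rewrite /degree => card3.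
have : [set w | e u w] :\ v != set0.
  rewrite -card_gt0; have := cardsD1 v [set w | e u w].
  by rewrite card3 inE euv; lia.
case/set0Pn=> w1; rewrite !inE => /andP[w1v euw1].
have c1 : #|[set w | e u w] :\ v :\ w1| = 1.
  have := cardsD1 w1 ([set w | e u w] :\ v).
  have := cardsD1 v [set w | e u w].
  by rewrite card3 !inE euv w1v euw1; lia.
have /eqP/cards1P[w2 /setP w2E] := c1.
have := w2E w2; rewrite !inE eqxx => /and3P[w21 w2v euw2].
exists (displayed v u), (displayed w1 u), (displayed w2 u).
split; [exact: nsw | exact: nsw | exact: nsw |].
suff -> : ~: (displayed v u :|: displayed w1 u :|: displayed w2 u) = set0.
  by rewrite cards0.
apply/eqP; rewrite -subset0; apply/subsetP => x.
rewrite in_setC !in_setU !displayed_component -/e => /negP[].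
have lu : bd_label D x != u.
  apply: contra_eqN d3 => /eqP <-.
  by have := bd_label_leaf D x; rewrite /leaf /degree => /eqP ->.
have [w euw xw] := component_neighbor tD lu.
have := w2E w; rewrite !in_setD1 in_set1 in_set euw andbT.
case: (eqVneq w w1) => [ww1 _|_]; first by rewrite -ww1 xw orbT.
case: (eqVneq w v) => [wv _|_ /esym/eqP ww2]; first by rewrite -wv xw.
by rewrite -ww2 xw !orbT.
Qed.

End BranchWidth.

(** * Three-colored cubic trees, and small branch-width from three non-spanning sets *)

(* [None] is the color of the center, which lies in no monochromatic side. *)
Definition edges_cut_monochromatic (K : Type) (V : finType) (e : rel V)
    (c : V -> option K) : Prop :=
  forall u v, e u v -> exists k,
    (forall x, x \in component e u v -> c x = Some k) \/
    (forall x, x \in component e v u -> c x = Some k).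

Lemma component_sub (V : finType) (e : rel V) (u v : V) (P : V -> Prop) :
  P u -> (forall x y, P x -> delete_edge e u v x y -> P y) ->
  forall x, x \in component e u v -> P x.
Proof.
move=> Pu step x; rewrite inE => /connectP[p pp ->].
elim/last_ind: p pp => [|p y IH] //=.
by rewrite rcons_path last_rcons => /andP[/IH Pz /(step _ _ Pz)].
Qed.

Definition claw (K : finType) : rel (option K) :=
  fun x y => (x == None) (+) (y == None).

(** A vertex on a [ucycle] of size above 2 has two distinct neighbors, which here only the center
    [None] can have. *)
Lemma claw_tree (K : finType) : is_tree (@claw K).
Proof.
have csym : symmetric (@claw K) by move=> x y; rewrite /claw addbC.
have cN x : connect (@claw K) x None.
  by case: x => [k|]; [exact: connect1 | exact: connect0].
split=> //; first by move=> x; rewrite /claw addbb.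
- by rewrite card_option.
- by move=> x y; rewrite (connect_trans (cN x)) // (sym_connect_sym csym).
move=> c uc; rewrite leqNgt; apply/negP => szc.
have cE : {subset c <= [:: None]}.
  case=> [k|] // /(ucycle_degree csym uc szc)[[y|] [[z|] []]] //.
have := uniq_leq_size _ cE; case/andP: uc => _ -> /(_ isT) /=.
by rewrite leqNgt (ltn_trans _ szc).
Qed.

Lemma claw_degree_None (K : finType) : degree (@claw K) None = #|K|.
Proof.
rewrite /degree cardsE -[RHS]/(#|K|.+1.-1) -card_option -(cardC1 None).
by apply: eq_card => -[].
Qed.

Lemma claw_degree_Some (K : finType) (k : K) : degree (@claw K) (Some k) = 1.
Proof.
rewrite /degree -(cards1 (None : option K)); apply: eq_card => x.
by rewrite !inE /claw /=.
Qed.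

Lemma claw_edges_cut_monochromatic (K : finType) :
  edges_cut_monochromatic (@claw K) id.
Proof.
have leafk (k : K) x : x \in component (@claw K) (Some k) None -> x = Some k.
  apply: (component_sub (P := eq^~ (Some k))) => // _ [y|] ->.
    by rewrite /delete_edge.
  by rewrite /delete_edge /= eqxx.
move=> [k|] [l|] // _; first by exists k; left; apply: leafk.
by exists l; right; apply: leafk.
Qed.

(** Retraction onto the old tree: composing a coloring with it lets the two new leaves inherit the
    color of [l]. *)
Definition grow_origin (V : finType) (l : V) (x : V + bool) : V :=
  if x is inl a then a else l.

(** The sides of an old edge retract into its old sides, and a new edge cuts off a single new
    leaf. *)
Lemma grow_edges_cut_monochromatic (K : Type) (V : finType) (e : rel V)
    (c : V -> option K) (l : V) (k : K) :
  c l = Some k -> edges_cut_monochromatic e c ->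
  edges_cut_monochromatic (grow e l) (c \o grow_origin l).
Proof.
move=> cl mono.
have proj u v x : x \in component (grow e l) (inl u) (inl v) ->
    grow_origin l x \in component e u v.
  apply: (component_sub (P := fun x => grow_origin l x \in component e u v)).
    exact: component_refl.
  move=> y z; rewrite !inE; case: y z => [a|a] [b|b] /= ux.
  - move=> ab; apply: connect_trans ux (connect1 _).
    by move: ab; rewrite /delete_edge /= !xpair_eqE.
  - by rewrite /delete_edge /= => /andP[/eqP <-].
  - by rewrite /delete_edge /= => /andP[/eqP ->].
  - by rewrite /delete_edge /=.
have new b x : x \in component (grow e l) (inr b) (inl l) -> x = inr b.
  apply: (component_sub (P := eq^~ (inr b))) => // _ [y|y] -> //.
  by rewrite /delete_edge /=; case/andP=> /eqP ->; rewrite eqxx.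
move=> [u|b] [v|b'] //=.
- case/mono=> i [Hi|Hi]; exists i; [left|right] => x /proj; exact: Hi.
- by move/eqP=> ->; exists k; right => x /new -> /=.
- by move/eqP=> ->; exists k; left => x /new -> /=.
Qed.

(** Each entry of [s] requests one more leaf of its color. The strict inequality, which the claw
    provides at the start, guarantees a leaf of that color to grow from. *)
Lemma tricolored_cubic_tree (s : seq 'I_3) :
  exists (V : finType) (e : rel V) (c : V -> option 'I_3),
    [/\ is_tree e, forall v, ~~ leaf e v -> degree e v = 3,
        edges_cut_monochromatic e c
      & forall k, count_mem k s < #|[set v | leaf e v & c v == Some k]|].
Proof.
elim: s => [|k s [V [e [c [te d3 mono cnt]]]]].
  exists (option 'I_3), (@claw _), id; split.
  - exact: claw_tree.
  - case=> [k|]; rewrite ?claw_degree_None ?card_ord //.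
    by rewrite /leaf claw_degree_Some.
  - exact: claw_edges_cut_monochromatic.
  move=> k; apply/card_gt0P; exists (Some k).
  by rewrite inE /leaf claw_degree_Some !eqxx.
have /card_gt0P[l] : 0 < #|[set v | leaf e v & c v == Some k]|.
  exact: leq_ltn_trans (cnt k).
rewrite inE => /andP[/eqP dl /eqP cl].
exists (V + bool)%type, (grow e l), (c \o grow_origin l); split.
- exact: grow_tree.
- case=> [v|b]; rewrite /leaf ?grow_degree_inr // grow_degree_inl.
  by case: (eqVneq v l) => [->|_]; rewrite ?dl // double0 addn0; exact: d3.
- exact: grow_edges_cut_monochromatic cl mono.
move=> i; have := cnt i; rewrite !cardsE -!sum1_card big_sumType /= !sum1_card.
rewrite (cardD1 l) !unfold_in /leaf dl cl eqxx /= => lt.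
(* [A] counts leaves among the old vertices and [B] among the two new ones. When [k = i], losing [l]
   and gaining two leaves nets the requested one. *)
set A := #|_|; set B := #|_|.
have leA : #|[predD1 [pred v | leaf e v & c v == Some i] & l]| <= A.
  apply/subset_leq_card/subsetP => v; rewrite !inE => /andP[vl /andP[lv cv]].
  by rewrite unfold_in /leaf grow_degree_inl (negPf vl) double0 addn0 cv andbT.
have eqB : B = (k == i) * 2.
  rewrite /B; case: (eqVneq k i) => [ki|nki].
    rewrite mul1n -[RHS]card_bool.
    apply: eq_card => b.
    have inB : (degree (grow e l) (inr b) == 1) && (Some k == Some i).
      by rewrite grow_degree_inr ki !eqxx.
    exact: inB.
  apply: eq_card0 => b; rewrite unfold_in grow_degree_inr /=.
  exact: negPf nki.
have : count_mem i s < (k == i) + A := leq_trans lt (leq_add (leqnn _) leA).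
by rewrite eqB; move: (count_mem i s) A {leA} => n m; case: (k == i); lia.
Qed.

Lemma branch_width_of_three_nonspanning (E : finType) (N : matroid E)
    (X1 X2 X3 : {set E}) :
  rk N X1 < rank N -> rk N X2 < rank N -> rk N X3 < rank N ->
  X1 :|: X2 :|: X3 = setT -> branch_width N <= rank N.
Proof.
move=> ns1 ns2 ns3 cov.
(* Requesting [#|E|] leaves of each color leaves room for any color class. *)
pose s : seq 'I_3 := flatten (nseq #|E| (enum 'I_3)).
have cnt k : count_mem k s = #|E|.
  rewrite /s count_flatten map_nseq sumn_nseq -[RHS]mul1n; congr (_ * _).
  by rewrite (count_uniq_mem _ (enum_uniq _)) mem_enum.
have [V [e [c [te d3 mono big]]]] := tricolored_cubic_tree s.
pose col x : 'I_3 :=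
  if x \in X1 then inord 0 else if x \in X2 then inord 1 else inord 2.
pose L k := [set v | leaf e v & c v == Some k].
have rkcol k : rk N [set x | col x == k] < rank N.
  have sub (X : {set E}) : rk N X < rank N -> [set x | col x == k] \subset X ->
      rk N [set x | col x == k] < rank N.
    by move=> ltX /(rk_mono N) le; apply: leq_ltn_trans ltX.
  have val_col x :
      val (col x) = if x \in X1 then 0 else if x \in X2 then 1 else 2.
    by rewrite /col; case: ifP => _; [|case: ifP => _]; rewrite /= inordK.
  case: k sub => [[|[|[|k]]] lt3] //= sub.
  - apply: (sub _ ns1); apply/subsetP => x; rewrite inE => /eqP/(congr1 val).
    by rewrite val_col; case: ifP => // _; case: ifP.
  - apply: (sub _ ns2); apply/subsetP => x; rewrite inE => /eqP/(congr1 val).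
    by rewrite val_col; case: ifP => // _; case: ifP.
  - apply: (sub _ ns3); apply/subsetP => x; rewrite inE => /eqP/(congr1 val).
    rewrite val_col; have : x \in X1 :|: X2 :|: X3 by rewrite cov inE.
    by rewrite !inE; case: ifP => // _; case: ifP.
(* [v0] is only the default of [nth]. Each [x] goes to the leaf of its color indexed by its rank in
   [E], so the leaf determines both color and index. *)
have [v0 _] : exists v0 : V, v0 \in predT by case: te => _ _ /card_gt0P.
pose f x := nth v0 (enum (L (col x))) (enum_rank x).
have rank_lt (x : E) k : enum_rank x < size (enum (L k)).
  by rewrite -cardE; apply: leq_trans (big k); rewrite ltnS cnt ltnW.
have fL x : f x \in L (col x) by rewrite -mem_enum mem_nth.
have injf : injective f.
  move=> x y eqf; have := fL y; rewrite -eqf; have := fL x.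
  rewrite !inE => /andP[_ /eqP ->] /andP[_ /eqP[eqc]].
  move: eqf; rewrite /f -eqc => /eqP; rewrite nth_uniq ?enum_uniq //.
  by move/eqP/ord_inj/enum_rank_inj.
have leaff x : leaf e (f x) by have := fL x; rewrite inE => /andP[].
pose D := BranchDecomposition te d3 injf leaff.
apply: leq_trans (branch_width_le N D) _; apply/bigmax_leqP => -[u v] /= euv.
(* A monochromatic side displays part of one color class, so its rank bounds the connectivity
   strictly below the full rank. *)
have side (a b : bd_vertex D) k :
    (forall x, x \in component e a b -> c x = Some k) ->
    rk N (displayed a b) < rank N.
  move=> ck; apply: leq_ltn_trans (rkcol k); apply: rk_mono.
  apply/subsetP => x; rewrite displayed_component inE /= => /ck.
  by have := fL x; rewrite inE => /andP[_ /eqP ->] [->].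
have [k [/side|/side]] := mono u v euv; apply: leq_ltn_trans.
  exact: connectivity_le_rk.
by rewrite -connectivityC displayedC // connectivity_le_rk.
Qed.

(** * Rank and branch-width of the t-expansion *)

Section Expansion.

Variables (E : finType) (t : nat) (M : matroid E).

Let N := expansion t M.

Lemma blowupT : blowup t [set: E] = setT.
Proof. by apply/setP => p; rewrite !inE. Qed.

(** The expansion prescribes ranks on blowups of cyclic flats only; a cyclic flat [B] with
    [r(A) = r(B) + |A - B|] carries the bound over to any [A]. *)
Lemma rk_expansion_blowup_le (A : {set E}) : rk N (blowup t A) <= t * rk M A.
Proof.
have [_ rN] := expansionP t M; have [B zB ->] := cyclic_flats_rank M A.
by rewrite mulnDr -rN // -card_blowup -blowupD rk_le_addD.
Qed.

Lemma rk_expansion (X : {set E * 'I_t}) :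
  exists A, rk N X = t * rk M A + #|X :\: blowup t A|.
Proof.
have [zN rN] := expansionP t M; have [C + ->] := cyclic_flats_rank N X.
by rewrite zN => /imsetP[A zA ->]; exists A; rewrite rN.
Qed.

Lemma rank_expansion : rank N = t * rank M.
Proof.
apply/eqP; rewrite /rank -blowupT eqn_leq rk_expansion_blowup_le /=.
have [A ->] := rk_expansion (blowup t [set: E]).
by rewrite blowupD card_blowup -mulnDr leq_mul2l rk_le_addD orbT.
Qed.

(** A proper flat has corank at least 1, so its blowup has corank at least [t] and stays
    non-spanning with [t - 1] further elements. The clones outside the flats are shared out among
    the three blowups. *)
Lemma branch_width_expansion_le (F1 F2 F3 : {set E}) :
  2 < t -> proper_flat M F1 -> proper_flat M F2 -> proper_flat M F3 ->
  #|[set: E] :\: (F1 :|: F2 :|: F3)| <= 2 ->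
  branch_width N <= rank N.
Proof.
move=> t3 pf1 pf2 pf3; set R := _ :\: _ => leR.
(* [2 * t <= 3 * (t - 1)]: this is where [3 <= t] is needed. *)
have : #|blowup t R| <= t.-1 + (t.-1 + t.-1) 
  by rewrite card_blowup; have := leq_mul (leqnn t) leR; lia.
case/card_split=> B1 [le1 /card_split[B2 [le2 le3]]].
have ns F (B : {set E * 'I_t}) : proper_flat M F -> #|B| <= t.-1 ->
    rk N (blowup t F :|: B) < rank N.
  move=> /proper_flat_nonspanning ltF leB.
  rewrite rank_expansion.
  have := rk_setU_card N (blowup t F) B; have := rk_expansion_blowup_le F.
  have : t * (rk M F).+1 <= t * rank M by rewrite leq_mul2l ltF orbT.
  rewrite mulnS; lia.
apply: branch_width_of_three_nonspanning (ns _ _ pf1 le1) (ns _ _ pf2 le2)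
  (ns _ _ pf3 le3) _.
apply/setP => p; rewrite !inE.
by do 3!case: (p.1 \in _) => //=; case: (p \in B1) => //=; case: (p \in B2).
Qed.

Lemma three_proper_flats_of_branch_width :
  0 < t -> branch_width N <= rank N ->
  exists F1 F2 F3 : {set E},
    [/\ proper_flat M F1, proper_flat M F2, proper_flat M F3
      & #|[set: E] :\: (F1 :|: F2 :|: F3)| <= 2].
Proof.
move=> t0 /three_nonspanning_of_branch_width[X1 [X2 [X3]]] [].
have [A1 ->] := rk_expansion X1; have [A2 ->] := rk_expansion X2.
have [A3 ->] := rk_expansion X3; rewrite rank_expansion => ns1 ns2 ns3 leX.
have ltA (A : {set E}) a : t * rk M A + a < t * rank M -> rk M A < rank M.
  by move=> lt; rewrite -(ltn_pmul2l t0) (leq_ltn_trans _ lt) // leq_addr.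
have lt1 := ltA _ _ ns1; have lt2 := ltA _ _ ns2; have lt3 := ltA _ _ ns3.
pose k (A : {set E}) := rank M - rk M A.
pose R := [set: E] :\: (A1 :|: A2 :|: A3).
(* A clone over [R] lies in some [X_i] outside its blowup, or in no [X_i]. The three strict rank
   bounds save 3 and the uncovered element costs 1, so [t * |R|] stays strictly below [t] times the
   sum of coranks. *)
have leR : #|R| < k A1 + (k A2 + k A3).
  rewrite -(ltn_pmul2l t0) -card_blowup /k !mulnDr !mulnBr.
  have : #|blowup t R| <= #|X1 :\: blowup t A1| + #|X2 :\: blowup t A2| +
      #|X3 :\: blowup t A3| + #|~: (X1 :|: X2 :|: X3)|.
    have sub : blowup t R \subset (X1 :\: blowup t A1) :|: (X2 :\: blowup t A2)
        :|: (X3 :\: blowup t A3) :|: ~: (X1 :|: X2 :|: X3).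
      apply/subsetP => p; rewrite !inE !negb_or andbT.
      move=> /andP[/andP[-> ->] ->] /=.
      by case: (p \in X1); case: (p \in X2); case: (p \in X3).
    apply: leq_trans (subset_leq_card sub) _.
    by do 3!(apply: leq_trans (leq_card_setU _ _) _; rewrite leq_add2r).
  lia.
(* All coranks are positive, so their sum minus 1 is the sum of the [k - 1] plus 2: this is the 2 of
   the statement. *)
have : #|R| <= (k A1).-1 + ((k A2).-1 + ((k A3).-1 + 2)).
  by rewrite /k in leR *; lia.
case/card_split=> B1 [le1 /card_split[B2 [le2]]].
case/card_split=> B3 [le3 le4].
(* Fewer new elements than the corank leave the set non-spanning. *)
have flat_of (A B : {set E}) : rk M A < rank M -> #|B| <= (k A).-1 ->
    exists2 F, proper_flat M F & A :|: B \subset F.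
  move=> lt le; apply: nonspanning_proper_flat.
  by have := rk_setU_card M A B; rewrite /k in le; lia.
have [F1 pf1 s1] := flat_of _ _ lt1 le1.
have [F2 pf2 s2] := flat_of _ _ lt2 le2.
have [F3 pf3 s3] := flat_of _ _ lt3 le3.
exists F1, F2, F3; split=> //; apply: leq_trans le4.
apply/subset_leq_card/subsetP => x.
have := contra (subsetP s1 x); have := contra (subsetP s2 x).
have := contra (subsetP s3 x); rewrite !inE !negb_or !andbT.
move=> out3 out2 out1 /andP[/andP[/out1/andP[-> ->] /out2/andP[-> ->]]].
by move=> /out3/andP[-> ->].
Qed.

End Expansion.

Theorem theorem6p3 (E : finType) (M : matroid E) :
  [<-> exists F1 F2 F3 : {set E},
         [/\ proper_flat M F1, proper_flat M F2, proper_flat M F3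
           & #|[set: E] :\: (F1 :|: F2 :|: F3)| <= 2];
       forall t : nat, 3 <= t ->
         branch_width (expansion t M) <= rank (expansion t M);
       exists2 t : nat, 3 <= t &
         branch_width (expansion t M) <= rank (expansion t M)]
  /\
  ((forall F1 F2 F3 A : {set E},
      proper_flat M F1 -> proper_flat M F2 -> proper_flat M F3 -> #|A| <= 2 ->
      [set: E] <> F1 :|: F2 :|: F3 :|: A) ->
   forall t : nat, 0 < t ->
     branch_width (expansion t M) = rank (expansion t M) + 1).
Proof.
split.
  tfae.
  - by move=> [F1 [F2 [F3 [pf1 pf2 pf3 le2]]]] t t3;
      exact: branch_width_expansion_le pf1 pf2 pf3 le2.
  - by move=> le; exists 3 => //; apply: le.
  - move=> [t t3]; apply: three_proper_flats_of_branch_width.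
    exact: leq_trans t3.
(* The upper bound holds for every matroid. The lower bound uses the passage back to flats, valid
   for all positive [t], with [A] the part of [E] missed by the flats. *)
move=> ncov t t0; apply/eqP; rewrite addn1 eqn_leq branch_width_le_rank1 ltnNge.
apply/negP => /(three_proper_flats_of_branch_width t0).
move=> [F1 [F2 [F3 [pf1 pf2 pf3 le2]]]].
apply: (ncov _ _ _ _ pf1 pf2 pf3 le2).
by apply/setP => x; rewrite !inE; do 3!case: (x \in _).
Qed.
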